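(* Let $H$ be a finite group containing a normal subgroup $C$ such that $C$ coincides with its centraliser in $H$, $C$ does not decompose into a direct product of nontrivial subgroups normal in $H$, and $|C|$ is coprime to $|H/C|$. Then $H$ is a retract of every finite group $G\supseteq H$ satisfying all identities of $H$. In particular, $H$ is strongly verbally closed.
   Context: A subgroup $H$ of $G$ is a retract of $G$ if there is an endomorphism $\rho$ of $G$ with $\rho\circ\rho=\rho$ and $\rho(G)=H$. A subgroup $H$ of $G$ is verbally closed if every equation $w(x_1,\dots,x_n)=h$ with $w$ in a free group and $h\in H$ solvable in $G$ is solvable in $H$; algebraically closed if every finite system of equations with coefficients from $H$ solvable in $G$ is solvable in $H$. A group is strongly verbally closed if it is algebraically closed in every group containing it as a verbally closed subgroup. *)

(* Defs.v *)
From HB Require Import structures.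
From Stdlib Require List.
From mathcomp Require Import all_boot all_fingroup.
Set Implicit Arguments. Unset Strict Implicit. Unset Printing Implicit Defensive.

(* Group terms: variables x_0, x_1, ... , constants from A, product, inverse, 1.
   A "word" (element of a free group) is a term without constants: term void. *)
Inductive term (A : Type) : Type :=
  | TVar of nat
  | TCst of A
  | TMul of term A & term A
  | TInv of term A
  | TOne.
Arguments TOne {A}.

Fixpoint teval (A T : Type) (mul : T -> T -> T) (inv : T -> T) (one : T)
    (c : A -> T) (v : nat -> T) (t : term A) : T :=
  match t with
  | TVar i => v i
  | TCst a => c a
  | TMul t1 t2 => mul (teval mul inv one c v t1) (teval mul inv one c v t2)
  | TInv t1 => inv (teval mul inv one c v t1)
  | TOne => one
  end.

Definition word := term void.

Definition geval (gT : finGroupType) (A : Type) (c : A -> gT) (v : nat -> gT)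
    (t : term A) : gT := teval (fun x y => (x * y)%g) (fun x => x^-1%g) 1%g c v t.

Definition satisfies_identities_of (gT : finGroupType) (G H : {set gT}) : Prop :=
  forall w : word,
    (forall v : nat -> gT, (forall i, v i \in H) -> geval (of_void gT) v w = 1%g) ->
    (forall v : nat -> gT, (forall i, v i \in G) -> geval (of_void gT) v w = 1%g).

Definition retract_of (gT : finGroupType) (H G : {group gT}) : Prop :=
  exists rho : {morphism G >-> gT},
    (rho @* G)%g = H /\ {in G, forall x, rho (rho x) = rho x}.

Record abs_group := AbsGroup {
  gcar :> Type;
  gmul : gcar -> gcar -> gcar;
  ginv : gcar -> gcar;
  gone : gcar;
  gmulA : forall x y z, gmul x (gmul y z) = gmul (gmul x y) z;
  gmul1 : forall x, gmul gone x = x;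
  gmulV : forall x, gmul (ginv x) x = gone
}.

Definition aeval (X : abs_group) (A : Type) (c : A -> X) (v : nat -> X) (t : term A) : X :=
  teval (@gmul X) (@ginv X) (gone X) c v t.

Definition embeds (gT : finGroupType) (H : {group gT}) (X : abs_group) (e : gT -> X) : Prop :=
  {in H &, forall x y, e (x * y)%g = gmul (e x) (e y)} /\ {in H &, injective e}.

Definition verbally_closed_in (gT : finGroupType) (H : {group gT}) (X : abs_group)
    (e : gT -> X) : Prop :=
  forall (w : word) (h : gT), h \in H ->
    (exists v : nat -> X, aeval (fun a => of_void X a) v w = e h) ->
    exists v : nat -> gT, (forall i, v i \in H) /\ geval (of_void gT) v w = h.

Fixpoint tconsts (A : Type) (t : term A) : seq A :=
  match t with
  | TVar _ => [::]
  | TCst a => [:: a]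
  | TMul t1 t2 => tconsts t1 ++ tconsts t2
  | TInv t1 => tconsts t1
  | TOne => [::]
  end.

Definition algebraically_closed_in (gT : finGroupType) (H : {group gT}) (X : abs_group)
    (e : gT -> X) : Prop :=
  forall S : seq (term gT),
    (forall t, List.In t S -> all (fun a => a \in H) (tconsts t)) ->
    (exists v : nat -> X, forall t, List.In t S -> aeval e v t = gone X) ->
    exists v : nat -> gT, (forall i, v i \in H) /\
      (forall t, List.In t S -> geval id v t = 1%g).

Definition strongly_verbally_closed (gT : finGroupType) (H : {group gT}) : Prop :=
  forall (X : abs_group) (e : gT -> X),
    embeds H e -> verbally_closed_in H e -> algebraically_closed_in H e.

(* Main.v *)
Require Import Defs.
From mathcomp Require Import all_boot all_fingroup all_solvable.
From mathcomp Require Import boolp.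
Set Implicit Arguments. Unset Strict Implicit. Unset Printing Implicit Defensive.
Local Open Scope group_scope.

(** [C] is an abelian [p]-group, and coprimality (Maschke, in the form of
    Gaschuetz's theorem) together with indecomposability makes it homocyclic of
    some exponent [p^(k+1)] with socle ['Ohm_1(C)] minimal normal in [H].

    Let [D] be a finite group of the variety of [H] containing [H].  Factor out a
    normal subgroup [R] maximal subject to [R :&: C = 1]; it meets [H]
    trivially since ['C_H(C) = C].  In [E := D / R], the Sylow [p]-subgroup [B]
    is normal, abelian, of exponent dividing [p^(k+1)], and by Maschke and the
    choice of [R] its socle [U] is minimal normal in [E], so [U] is the image of
    [B] under [p^k]-th powers.  Writing [E] as a quotient of a subgroup [F] of a
    power of [H], minimality of [U] exhibits it as a quotient of a subgroup of
    ['Ohm_1(C)] sitting in a single coordinate; this gives both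
    [#|U| <= #|'Ohm_1(C)|], whence [B = C], and
    [#|E : 'C_E(U)| <= #|H : C|] with ['C_E(U) = B].  Hence [E = H], and
    [D -> E] is the retraction.

    For an arbitrary group [X] with [H] verbally closed in it, the values in [X]
    of the laws of [H] form a normal subgroup meeting [H] trivially, and the
    subgroup generated by [H] and a solution of a finite system of equations
    becomes finite modulo it: it is a quotient of a finite relatively free group. *)

(** * Coprime action on abelian normal subgroups *)

(** A complement given by [splits] need not be normal. Gaschuetz's theorem yields a complement [K]
    of [X] in [U * L], where [L] complements [B] in [G]; then [K :&: U] is centralised by [B] and
    normalised by [X * K], which contains [L]. *)
Lemma maschke_complement (gT : finGroupType) (G B U X : {group gT}) :
    B <| G -> abelian B -> coprime #|B| #|G : B| ->
    U <| G -> U \subset B -> X <| G -> X \subset U -> [splits U, over X] ->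
  exists Y : {group gT}, Y <| G /\ X \x Y = U.
Proof.
move=> nsBG cBB coB nsUG sUB nsXG sXU splU.
have [sBG nBG] := andP nsBG; have [sUG nUG] := andP nsUG.
have [sXG nXG] := andP nsXG.
have hallB : Hall G B by rewrite /Hall sBG.
have /splitsP[L /complP[tiBL defG]] := SchurZassenhaus_split hallB nsBG.
have sLG : L \subset G by rewrite -defG mulG_subr.
have nUL : L \subset 'N(U) := subset_trans sLG nUG.
pose P := (U <*> L)%G.
have defP : U * L = P by rewrite -norm_joinEr.
have sUP : U \subset P by rewrite /= joing_subl.
have sLP : L \subset P by rewrite /= joing_subr.
have sPG : P \subset G by rewrite /= join_subG sUG sLG.
have nsXP : X <| P by apply: normalS nsXG; rewrite // (subset_trans sXU).
have cXX : abelian X := abelianS (subset_trans sXU sUB) cBB.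
have tiUL : U :&: L = 1 by apply/trivgP; rewrite -tiBL setSI.
have coX : coprime #|X| #|P : U|.
  rewrite -divgS // -defP TI_cardMg // mulKn ?cardG_gt0 //.
  apply: coprimeSg (subset_trans sXU sUB) _.
  by move: coB; rewrite -divgS // -{1}defG TI_cardMg // mulKn ?cardG_gt0.
have := Gaschutz_split nsXP sXU sUP cXX coX; rewrite splU => splP.
have /splitsP[K /complP[tiXK defXK]] := splP.
have sKP : K \subset P by rewrite -defXK mulG_subr.
exists (K :&: U)%G; split.
  apply/andP; split; first by rewrite /= subIset // sUG orbT.
  have cY (Z : {set gT}) : Z \subset B -> Z \subset 'N(K :&: U).
    by move=> sZB; rewrite cents_norm // (sub_abelian_cent2 cBB) // subIset // sUB orbT.
  have nYK : K \subset 'N(K :&: U).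
    by rewrite normsI ?normG // (subset_trans sKP) // (subset_trans sPG).
  rewrite -defG mul_subG ?(cY B) //= (subset_trans sLP) // -defXK.
  by rewrite mul_subG // (cY X) // (subset_trans sXU).
rewrite dprodE /=.
- by rewrite group_modl // defXK (setIidPr sUP).
- by rewrite (sub_abelian_cent2 cBB) ?(subset_trans sXU) // subIset // sUB orbT.
- by apply/trivgP; rewrite -tiXK setIS // subsetIl.
Qed.

Lemma Ohm1_abelianP (gT : finGroupType) (p : nat) (A : {group gT}) :
    p.-group A -> abelian A ->
  forall x, (x \in 'Ohm_1(A)) = (x \in A) && (x ^+ p == 1).
Proof.
move=> pA cAA x; rewrite (OhmEabelian pA) ?(abelianS (Ohm_sub _ _)) //.
by rewrite expn1 !inE.
Qed.

Lemma Mho_abelianP (gT : finGroupType) (p k : nat) (A : {group gT}) :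
    p.-group A -> abelian A ->
  forall x, reflect (exists2 a, a \in A & x = a ^+ (p ^ k)) (x \in 'Mho^k(A)).
Proof. by move=> pA cAA x; rewrite (MhoEabelian _ pA cAA); apply: imsetP. Qed.

(* [Y] is a supplement of [T] in [C] of minimal order; then [Y :&: T] lies in
   the Frattini subgroup [Y ^ p], and freeness of [C / T] over [Z / p^e] pushes
   it into every [Y ^ (p ^ j)]. *)
Lemma splits_homocyclic_quotient (gT : finGroupType) (p e : nat) (C T : {group gT}) :
    p.-group C -> abelian C -> T \subset C ->
    {in C, forall c, c ^+ (p ^ e) = 1} ->
    (forall j c, j <= e -> c \in C -> c ^+ (p ^ j) \in T ->
       exists d t, [/\ d \in C, t \in T & c = d ^+ (p ^ (e - j)) * t]) ->
  [splits C, over T].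
Proof.
move=> pC cCC sTC expC freeC.
have [Y /mingroupP[/eqP defC minY] sYC] :
    {Y : {group gT} | mingroup Y (fun Y : {group gT} => T * Y == C) & Y \subset C}.
  by apply: mingroup_exists; rewrite mulSGid.
have pY := pgroupS sYC pC; have cYY := abelianS sYC cCC.
have comm x y : x \in C -> y \in C -> commute x y.
  by move=> Cx Cy; apply: (centsP cCC).
(* If a maximal subgroup [M] of [Y] did not contain [Y :&: T], then [Y = M * (Y :&: T)] and [M]
   would be a smaller supplement of [T]. *)
have sYT_Phi : Y :&: T \subset 'Phi(Y).
  apply/bigcapsP=> M /predU1P[->|maxM]; first exact: subsetIl.
  have [/andP[sMY ltMY] _] := maxgroupP maxM.
  apply/negPn/negP=> nsM; case/negP: ltMY.
  have defY : M * (Y :&: T) = Y.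
    by rewrite (mulg_normal_maximal (p_maximal_normal pY maxM)) ?subsetIl.
  rewrite -(minY M) //=; apply/eqP; rewrite -defC -defY mulgA.
  have cTM : commute (M : {set gT}) (Y :&: T).
    by apply/centC/(sub_abelian_cent2 cYY); rewrite ?subsetIl.
  by rewrite -mulgA cTM mulgA (@mulGSid _ T (Y :&: T)) ?subsetIr.
apply/splitsP; exists Y; apply/complP; split=> //.
apply/trivgP/subsetP=> u /setIP[Tu Yu]; apply/set1P.
have sYTM : forall t, t \in Y -> t \in T -> exists2 s, s \in Y & t = s ^+ p.
  move=> t Yt Tt; have : t \in 'Mho^1(Y).
    by rewrite -(Phi_Mho pY cYY) (subsetP sYT_Phi) // inE Yt.
  by case/(Mho_abelianP 1 pY cYY) => s Ys ->; exists s; rewrite // expn1.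
suff [y Yy ->] : exists2 y, y \in Y & u = y ^+ (p ^ e).
  by rewrite expC // (subsetP sYC).
have: e <= e by []; elim: {1 3}e => [_|j IHj lt_je].
  by exists u; rewrite ?expg1.
have [z Yz def_u] := IHj (ltnW lt_je).
have [d [t [Cd Tt def_z]]] : exists d t, [/\ d \in C, t \in T & z = d ^+ (p ^ (e - j)) * t].
  by apply: freeC; rewrite ?(ltnW lt_je) ?(subsetP sYC) // -def_u.
have : d \in T * Y by rewrite defC.
case/mulsgP=> t0 w Tt0 Yw def_d.
have [Ct0 Cw Ct] : [/\ t0 \in C, w \in C & t \in C].
  by rewrite (subsetP sTC) // (subsetP sYC) // (subsetP sTC).
pose t1 := t0 ^+ (p ^ (e - j)) * t.
have Tt1 : t1 \in T by rewrite groupM ?groupX.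
have def_z1 : z = w ^+ (p ^ (e - j)) * t1.
  rewrite def_z def_d expgMn; last exact: comm.
  rewrite /t1 mulgA; congr (_ * _); apply: comm; exact: groupX.
(* Both [z] and the power of [w] lie in [Y], so [t1] lies in [Y :&: T] and is a [p]-th power;
   raising to the power [p ^ j] then kills the part in [w]. *)
have Yt1 : t1 \in Y by rewrite -(groupMl t1 (groupX (p ^ (e - j)) Yw)) -def_z1.
have [s Ys def_t1] := sYTM _ Yt1 Tt1.
exists s => //; rewrite def_u def_z1 expgMn; last first.
  by apply: comm; rewrite (subsetP sYC) ?groupX.
rewrite -expgM -expnD subnK ?(ltnW lt_je) // expC // mul1g def_t1 -expgM.
by rewrite -expnS.
Qed.

(** * Structure of an indecomposable normal subgroup *)

Definition normal_indecomposable (gT : finGroupType) (H C : {group gT}) : Prop :=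
  ~ (exists A B : {group gT},
       [/\ A <| H, B <| H, A :!=: 1, B :!=: 1 & A \x B = C]).

(** The cores of [C] for [p] and for its complement are characteristic in [C], hence normal in [H],
    and [C] is their direct product. *)
Lemma indecomposable_pgroup (gT : finGroupType) (H C : {group gT}) :
    C <| H -> abelian C -> C :!=: 1 ->
    normal_indecomposable H C ->
  exists2 p, prime p & p.-group C.
Proof.
move=> nsCH cCC ntC indecC.
have p_pr : prime (pdiv #|C|) by rewrite pdiv_prime // cardG_gt1.
set p := pdiv #|C| in p_pr.
have defC := nilpotent_pcoreC p (abelian_nil cCC).
exists p => //; rewrite -[X in _.-group X]defC.
have [-> | ntp'] := eqVneq 'O_p^'(C) 1; first by rewrite dprodg1 pcore_pgroup.
case: indecC; exists 'O_p(C)%G, 'O_p^'(C)%G; split=> //.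
- exact: gFnormal_trans.
- exact: gFnormal_trans.
apply/eqP=> /= Op1; have := pcore_pgroup p^' C.
move: defC; rewrite Op1 dprod1g => ->; rewrite /pgroup p'natE //.
by rewrite pdiv_dvd.
Qed.

Lemma indecomposable_irreducible_socle (gT : finGroupType) (H C : {group gT}) :
    C <| H -> abelian C -> C :!=: 1 -> coprime #|C| #|H : C| ->
    normal_indecomposable H C ->
  exists p k, [/\ prime p, p.-group C, {in C, forall c, c ^+ (p ^ k.+1) = 1},
                  'Ohm_1(C) \subset 'Mho^k(C) & minnormal 'Ohm_1(C) H].
Proof.
move=> nsCH cCC ntC coC indecC; have [sCH nCH] := andP nsCH.
have [p p_pr pC] := indecomposable_pgroup nsCH cCC ntC indecC.
have [k defe] : exists k, exponent C = (p ^ k.+1)%N.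
  have /p_natP[[|k] ek] : p.-nat (exponent C) by rewrite pnat_exponent.
    by case/negP: ntC; rewrite trivg_exponent ek.
  by exists k.
have expC : {in C, forall c, c ^+ (p ^ k.+1) = 1}.
  by move=> c Cc; rewrite -defe expg_exponent.
exists p, k.
have ntM : 'Mho^k(C) != 1.
  apply: contraTneq (dvdnn (exponent C)) => M1; rewrite {1}defe.
  suff dvd_e : exponent C %| p ^ k.
    apply/negP=> dvd_e2; have := dvdn_leq _ (dvdn_trans dvd_e2 dvd_e).
    by rewrite expn_gt0 prime_gt0 // leq_exp2l ?prime_gt1 // ltnn => /(_ isT).
  apply/exponentP=> c Cc; apply/set1gP; rewrite -M1.
  by apply/(Mho_abelianP k pC cCC); exists c.
have nsMH : 'Mho^k(C) <| H by apply: gFnormal_trans.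
have [S minS sSM] := minnormal_exists ntM (normal_norm nsMH).
have [/andP[ntS nSH] minS'] := mingroupP minS.
have sSC : S \subset C := subset_trans sSM (Mho_sub _ _).
have nsSH : S <| H by rewrite /normal (subset_trans sSC).
(* [T] is taken as large as possible while avoiding [S]: then [C / T] will be homocyclic with socle
   [S / T], which makes [T] a direct factor. *)
pose gP (T : {group gT}) := [&& T <| H, T \subset C & T :&: S == 1].
have [T /maxgroupP[/and3P[nsTH sTC /eqP tiTS] maxT] _] :
    {T : {group gT} | maxgroup T gP & 1%G \subset T}.
  by apply: maxgroup_exists; rewrite /gP normal1 sub1G /= -subG1 subsetIl.
have [sTH nTH] := andP nsTH; have nTC := subset_trans sCH nTH.
have pCT : p.-group (C / T) by rewrite quotient_pgroup.
have cCT : abelian (C / T) by rewrite quotient_abelian.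
have socleCT : 'Ohm_1(C / T) = S / T.
  have sST : S / T \subset 'Ohm_1(C / T).
    apply/subsetP=> _ /morphimP[s Ns Ss ->]; rewrite (Ohm1_abelianP pCT cCT).
    rewrite mem_quotient ?(subsetP sSC) //= -morphX //.
    have /(Mho_abelianP k pC cCC)[c Cc ->] := subsetP sSM _ Ss.
    by rewrite -expgM -expnSr expC // morph1.
  (* A normal complement of [S / T] in the socle has a preimage that avoids [S], so this preimage is
     [T] by maximality. *)
  have [||||||||Y [nsYH defY]] :=
    @maschke_complement _ (H / T)%G (C / T)%G 'Ohm_1(C / T)%G (S / T)%G.
  - exact: quotient_normal.
  - by [].
  - by rewrite index_quotient_eq ?subIset ?sTC ?orbT // coprime_morphl.
  - by apply: gFnormal_trans; apply: quotient_normal.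
  - exact: Ohm_sub.
  - exact: quotient_normal.
  - by [].
  - exact: abelem_splits (Ohm1_abelem pCT cCT) sST.
  have [Y1 defY1 sTY1 nsY1H] := inv_quotientN nsTH nsYH.
  have [_ defO _ tiSY] := dprodP defY.
  have sY1C : Y1 \subset C.
    rewrite -(quotientSGK _ sTC) ?(subset_trans (normal_sub nsY1H)) //.
    by rewrite -defY1 (subset_trans _ (Ohm_sub 1 _)) // -defO mulG_subr.
  have tiY1S : Y1 :&: S = 1.
    apply/trivgP; rewrite -tiTS subsetI subsetIr andbT.
    rewrite -quotient_sub1 ?(subset_trans (subsetIr _ _)) ?(subset_trans sSC) //.
    rewrite -tiSY subsetI !quotientS ?subsetIr //= defY1.
    by rewrite quotientS ?subsetIl.
  have Y1T : Y1 :=: T by apply: maxT; rewrite // /gP nsY1H sY1C tiY1S /=.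
  by rewrite -defY defY1 Y1T trivg_quotient dprodg1.
have socleST c : c \in C -> c ^+ p \in T ->
    exists2 s, s \in S & exists2 t, t \in T & c = s * t.
  move=> Cc Tcp; have : coset T c \in S / T.
    rewrite -socleCT (Ohm1_abelianP pCT cCT) mem_quotient //= -morphX ?(subsetP nTC) //.
    by apply/eqP/coset_id.
  case/morphimP=> s Ns Ss /(rcoset_kercosetP (subsetP nTC _ Cc) Ns).
  case/rcosetP=> t Tt ->; exists s => //; exists t => //.
  by apply: (centsP cCC); [apply: (subsetP sTC) | apply: (subsetP sSC)].
have free1 c : c \in C -> c ^+ p \in T ->
    exists d t, [/\ d \in C, t \in T & c = d ^+ (p ^ k) * t].
  move=> Cc /(socleST _ Cc)[s Ss [t Tt ->]].
  by have /(Mho_abelianP k pC cCC)[d Cd ->] := subsetP sSM _ Ss; exists d, t.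
have free j c : j <= k.+1 -> c \in C -> c ^+ (p ^ j) \in T ->
    exists d t, [/\ d \in C, t \in T & c = d ^+ (p ^ (k.+1 - j)) * t].
  elim: j c => [|j IHj] c lej Cc Tc.
    exists 1, c; rewrite expg1n mul1g group1; split=> //.
  have [||d [t [Cd Tt def_cp]]] := free1 (c ^+ (p ^ j)); first exact: groupX.
    by rewrite -expgM -expnSr.
  (* Chosen so that [d1 ^+ (p ^ j) = d ^+ (p ^ k)]: dividing [c] by [d1] brings its [p ^ j]-th power
     into [T]. *)
  pose d1 := d ^+ (p ^ (k - j)).
  have Cd1 : d1 \in C by rewrite groupX.
  have [||| d2 [t2 [Cd2 Tt2 def_c]]] := IHj (d1^-1 * c).
  - exact: ltnW.
  - by rewrite groupM ?groupV.
  - rewrite expgMn; last by apply: (centsP cCC); rewrite ?groupV.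
    by rewrite def_cp expgVn -expgM -expnD subnK // mulKg.
  exists (d * d2 ^+ p), t2; split=> //; first by rewrite groupM ?groupX.
  rewrite subSS expgMn; last by apply: (centsP cCC); rewrite ?groupX.
  by rewrite -expgM -expnS -subSn // -mulgA -def_c mulKVg.
have splT := splits_homocyclic_quotient pC cCC sTC expC free.
have [Z [nsZH defC]] := maschke_complement nsCH cCC coC nsCH (subxx C) nsTH sTC splT.
(* If [T] were nontrivial, [T] and [Z] would decompose [C]; [Z] is nontrivial because [T] avoids
   [S]. *)
have [T1 | ntT] := eqVneq T 1%G; last first.
  case: indecC; exists T, Z; split=> //.
  apply: contra ntS => /eqP Z1; rewrite -subG1 -tiTS subsetI subxx andbT.
  by move: defC; rewrite Z1 dprodg1 => ->.
have socleC : 'Ohm_1(C) = S.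
  apply/setP=> c; rewrite (Ohm1_abelianP pC cCC).
  apply/andP/idP=> [[Cc /eqP cp1] | Sc].
    have [|s Ss [t]] := socleST c Cc; first by rewrite cp1 group1.
    by rewrite T1 => /set1P-> ->; rewrite mulg1.
  split; first exact: (subsetP sSC).
  have /(Mho_abelianP k pC cCC)[d Cd ->] := subsetP sSM _ Sc.
  by rewrite -expgM -expnSr expC.
by split; rewrite // socleC.
Qed.

(** * Finite groups in the variety of [H] *)

Lemma leq_indexgl (gT : finGroupType) (K G M : {group gT}) :
  K \subset G -> #|K : M| <= #|G : M|.
Proof. by move=> sKG; apply/subset_leq_card/imsetS. Qed.

(** Coordinates are discarded one by one: the part of [W] with trivial coordinate [i] has a normal
    image inside [U], hence [1] or [U]. In the first case [psi] on [W] depends only on coordinate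
    [i]; in the second [W] shrinks to that part. Not all coordinates can go, since together they
    separate [F] and [U] is nontrivial. *)
Lemma minnormal_image_coordinate (gT fT eT : finGroupType) (F W : {group fT})
    (I : finType) (pi_ : I -> {morphism F >-> gT}) (psi : {morphism F >-> eT})
    (U : {group eT}) :
    {in F, forall f, (forall i, pi_ i f = 1) -> f = 1} ->
    minnormal U (psi @* F) -> W <| F -> psi @* W = U ->
  exists (i : I) (W1 : {group fT}),
    [/\ W1 <| F, W1 \subset W, psi @* W1 = U
      & {in W1, forall w, pi_ i w = 1 -> psi w = 1}].
Proof.
move=> sepF /mingroupP[/andP[ntU nUE] minU] nsWF imW.
have : {in W, forall f, (forall i, i \in enum I -> pi_ i f = 1) -> f = 1}.
  move=> f Wf fP; apply: sepF => [|i]; first exact: (subsetP (normal_sub nsWF)).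
  by rewrite fP // mem_enum.
elim: (enum I) W nsWF imW => [|i r IHr] W nsWF imW sepW.
  case/negP: ntU; rewrite -imW -subG1; apply/subsetP=> _ /morphimP[w Fw Ww ->].
  by rewrite (sepW w Ww) // morph1 group1.
pose W2 := (W :&: 'ker (pi_ i))%G.
have nsW2F : W2 <| F by rewrite normalI // ker_normal.
have [W2_1 | ntW2] := eqVneq (psi @* W2) 1.
  exists i, W; split=> // w Ww pw1; apply/set1gP; rewrite -W2_1.
  have Fw := subsetP (normal_sub nsWF) w Ww.
  by apply/mem_morphim=> //; rewrite inE Ww; apply/kerP.
have imW2 : psi @* W2 = U.
  apply: minU; last by rewrite -imW morphimS ?subsetIl.
  by rewrite ntW2 normal_norm // morphim_normal.
have [|j [W1 [nsW1 sW1 imW1 sepW1]]] := IHr W2 nsW2F imW2.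
  move=> w /setIP[Ww /mker w1] wr; apply: sepW => // j.
  by rewrite inE => /predU1P[-> // | /wr].
by exists j, W1; split=> //; apply: subset_trans sW1 (subsetIl _ _).
Qed.

Lemma pi_group_expn (gT : finGroupType) (pi : nat_pred) (G : {group gT}) (n : nat) :
  pi.-nat n -> {in G, forall x, x ^+ n = 1} -> pi.-group G.
Proof.
by move=> pin /exponentP expG; rewrite -pnat_exponent (pnat_dvd expG).
Qed.

(* The last hypothesis says that [C] is free over [Z / p^(k+1)] with the same
   socle as [B]. *)
Lemma eq_of_socle_sub (gT : finGroupType) (p k : nat) (B C : {group gT}) :
    p.-group B -> abelian B -> C \subset B ->
    {in B, forall b, b ^+ (p ^ k.+1) = 1} ->
    'Ohm_1(B) \subset 'Mho^k(C) -> C :=: B.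
Proof.
move=> pB cBB sCB expB sOM; apply/eqP; rewrite eqEsubset sCB /=.
have pC := pgroupS sCB pB; have cCC := abelianS sCB cBB.
suff step j b : j <= k.+1 -> b \in B -> b ^+ (p ^ j) = 1 -> b \in C.
  by apply/subsetP=> b Bb; apply: (step k.+1); rewrite ?expB.
elim: j b => [|j IHj] b lej Bb bj1; first by rewrite -[b]expg1 bj1.
have : b ^+ (p ^ j) \in 'Ohm_1(B).
  by rewrite (Ohm1_abelianP pB cBB) groupX //= -expgM -expnSr bj1.
case/(subsetP sOM)/(Mho_abelianP k pC cCC) => c Cc def_b.
(* This element of [C] has the same [p ^ j]-th power as [b], so their quotient falls under the
   induction hypothesis. *)
have Cd : c ^+ (p ^ (k - j)) \in C by rewrite groupX.
have Bd := subsetP sCB _ Cd.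
rewrite -(groupMl b (groupVr Cd)); apply: IHj; rewrite ?(ltnW lej) ?groupM ?groupV //.
rewrite expgMn; last by apply: (centsP cBB); rewrite ?groupV.
by rewrite def_b expgVn -expgM -expnD subnK // mulVg.
Qed.

(** By coprime action [[~: B, M]] meets ['C_B(M)] trivially, where [M] is the centraliser on the
    left. Since ['C_B(M)] contains the socle of [B], the commutator avoids that socle and is
    trivial. *)
Lemma faithful_Ohm1_abelian (gT : finGroupType) (B L : {group gT}) :
    abelian B -> L \subset 'N(B) -> coprime #|B| #|L| ->
  'C_L('Ohm_1(B)) \subset 'C(B).
Proof.
move=> cBB nBL coBL; pose M := 'C_L('Ohm_1(B))%G.
have nBM : M \subset 'N(B) by rewrite subIset ?nBL.
have coBM : coprime #|B| #|M| by rewrite (coprimegS (subsetIl _ _)).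
have sBMB : [~: B, M] \subset B by rewrite commg_subl.
rewrite -[_ \subset _]/(M \subset 'C(B)) centsC; apply/commG1P.
rewrite -(setIidPl sBMB); apply: (TI_Ohm1 (H := [~: B, M]%G)).
apply/trivgP; rewrite -(coprime_abel_cent_TI nBM coBM cBB) setIS //.
by rewrite centsC subsetIr.
Qed.

(** * Subdirect quotients whose nontrivial normal subgroups all meet [C] *)

Section IrreducibleCase.

Variables (gT fT eT : finGroupType) (H C : {group gT}) (F : {group fT}).
Variables (I : finType) (pi_ : I -> {morphism F >-> gT}).
Variables (psi : {morphism F >-> eT}) (iota : {morphism H >-> eT}).
Variables (p k : nat).
Hypotheses (p_pr : prime p) (nsCH : C <| H) (pC : p.-group C) (cCC : abelian C).
Hypotheses (coC : coprime #|C| #|H : C|).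
Hypotheses (expC : {in C, forall c, c ^+ (p ^ k.+1) = 1}).
Hypotheses (sOM : 'Ohm_1(C) \subset 'Mho^k(C)) (minC : minnormal 'Ohm_1(C) H).
Hypotheses (piH : forall i, pi_ i @* F \subset H).
Hypotheses (sepF : {in F, forall f, (forall i, pi_ i f = 1) -> f = 1}).
Hypotheses (inj_iota : 'injm iota) (sHE : iota @* H \subset psi @* F).
Hypotheses (meetC : forall N : {group eT}, N <| psi @* F ->
              N :&: iota @* C = 1 -> N :=: 1).

Let E := (psi @* F)%G.
Let C' := (iota @* C)%G.
(** The trace on [F] of a power of [C]; its image [B] turns out to be the normal Sylow [p]-subgroup
    of [E]. *)
Let A := (F :&: \bigcap_i pi_ i @*^-1 C)%G.
Let B := (psi @* A)%G.
Let U := 'Ohm_1(B)%G.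
Let S := 'Ohm_1(C')%G.

Let sCH : C \subset H. Proof. exact: normal_sub. Qed.

Let piF i f : f \in F -> pi_ i f \in H.
Proof. by move=> Ff; apply/(subsetP (piH i))/mem_morphim. Qed.

Let memA f : reflect (f \in F /\ forall i, pi_ i f \in C) (f \in A).
Proof.
apply: (iffP setIP) => -[Ff fP]; split=> //.
  by move=> i; have /bigcapP/(_ i isT)/morphpreP[] := fP.
by apply/bigcapP=> i _; apply/morphpreP.
Qed.

Let sAF : A \subset F. Proof. exact: subsetIl. Qed.

Let nsAF : A <| F.
Proof.
rewrite /normal sAF; apply/subsetP=> x Fx; rewrite inE.
apply/subsetP=> _ /imsetP[a /memA[Fa aP] ->]; apply/memA.
split=> [|i]; first by rewrite groupJ.
by rewrite morphJ // memJ_norm ?aP // (subsetP (normal_norm nsCH)) ?piF.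
Qed.

Let cAA : abelian A.
Proof.
apply/centsP=> a /memA[Fa aP] b /memA[Fb bP]; apply/commgP/eqP.
apply: sepF => [|i]; first by rewrite groupR.
by rewrite morphR //; apply/eqP/commgP/(centsP cCC).
Qed.

Let expA : {in A, forall a, a ^+ (p ^ k.+1) = 1}.
Proof.
move=> a /memA[Fa aP]; apply: sepF => [|i]; first by rewrite groupX.
by rewrite morphX // expC.
Qed.

Let expB : {in B, forall b, b ^+ (p ^ k.+1) = 1}.
Proof. by move=> _ /morphimP[a Fa Aa ->]; rewrite -morphX // expA ?morph1. Qed.

Let cBB : abelian B. Proof. exact: morphim_abelian. Qed.

Let pA : p.-group A.
Proof. by apply: pi_group_expn expA; rewrite pnatX pnat_id. Qed.

Let pB : p.-group B. Proof. exact: morphim_pgroup. Qed.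

Let nsBE : B <| E. Proof. exact: morphim_normal. Qed.

Let ntO : 'Ohm_1(C) != 1.
Proof. by have [/andP[]] := mingroupP minC. Qed.

Let p'HC : p^'.-nat #|H : C|.
Proof.
have ntC : C :!=: 1 by apply: contraNneq ntO => ->; rewrite -subG1 Ohm_sub.
have [_ pdvC _] := pgroup_pdiv pC ntC.
rewrite p'natE ?indexg_gt0 // -prime_coprime //.
by apply: coprime_dvdl coC.
Qed.

(** The power [#|H : C|] sends every coordinate into [C], hence [F] into [A], so [E / B] has
    exponent prime to [p]. *)
Let p'EB : p^'.-nat #|E : B|.
Proof.
rewrite -card_quotient ?normal_norm //; apply: pi_group_expn p'HC _.
move=> _ /morphimP[e Ne Ee ->]; case/morphimP: Ee Ne => f Ff _ -> Ne.
rewrite -!morphX //.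
apply: coset_id; apply: mem_morphim; first by rewrite groupX.
apply/memA.
split=> [|i]; first by rewrite groupX.
have Hf := piF i Ff; have Nf := subsetP (normal_norm nsCH) _ Hf.
rewrite morphX // coset_idr ?groupX // morphX // -card_quotient ?normal_norm //.
by rewrite expg_cardG ?mem_quotient.
Qed.

Let sC'E : C' \subset E. Proof. exact: subset_trans (morphimS _ sCH) sHE. Qed.

Let sylB : p.-Hall(E) B. Proof. by rewrite /pHall normal_sub // pB p'EB. Qed.

Let sC'B : C' \subset B.
Proof. by rewrite (sub_normal_Hall sylB) ?morphim_pgroup. Qed.

Let coB : coprime #|B| #|E : B|.
Proof. by case/andP: (pHall_Hall sylB). Qed.

Let defS : S :=: iota @* 'Ohm_1(C).
Proof. by rewrite injm_Ohm. Qed.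

Let minS : minnormal S (iota @* H).
Proof. by rewrite defS injm_minnormal ?gFsub_trans. Qed.

Let ntS : S :!=: 1.
Proof. by have [/andP[]] := mingroupP minS. Qed.

(** [N] meets [C'], hence its socle [S], and [S] is minimal normal under the image of [H]. *)
Let socle_sub (N : {group eT}) : N <| E -> N :!=: 1 -> S \subset N.
Proof.
move=> nsNE ntN; have [/andP[_ nSH] minS'] := mingroupP minS.
have <- : N :&: S = S.
  apply: (minS' (N :&: S)%G); rewrite ?subsetIr //; apply/andP; split.
    by apply: contra ntN => /eqP/TI_Ohm1/(meetC nsNE)->.
  by rewrite normsI // (subset_trans sHE) // normal_norm.
exact: subsetIl.
Qed.

Let sUB : U \subset B. Proof. exact: Ohm_sub. Qed.
Let nsUE : U <| E. Proof. exact: gFnormal_trans. Qed.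
Let sSU : S \subset U. Proof. exact: OhmS. Qed.

(** Two complementary nontrivial normal parts of [U] would both contain [S]. *)
Let minU : minnormal U E.
Proof.
apply/mingroupP; split=> [|X /andP[ntX nXE] sXU].
  by rewrite (subG1_contra sSU) // normal_norm.
have nsXE : X <| E by rewrite /normal nXE (subset_trans sXU) ?normal_sub.
have splX : [splits U, over X] := abelem_splits (Ohm1_abelem pB cBB) sXU.
have [Y [nsYE defU]] := maschke_complement nsBE cBB coB nsUE sUB nsXE sXU splX.
have [_ _ _ tiXY] := dprodP defU.
have [Y1 | ntY] := eqVneq (Y : {set eT}) 1; first by rewrite -defU Y1 dprodg1.
by case/negP: ntS; rewrite -subG1 -tiXY subsetI !socle_sub.
Qed.

(** By minimality of [U] it is enough that ['Mho^k(B)] be nontrivial and lie in [U]: it contains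
    [S], and the exponent of [B] bounds it. *)
Let imW : psi @* 'Mho^k(A) = U.
Proof.
have [_ minU'] := mingroupP minU; rewrite morphim_Mho //.
apply: (minU' 'Mho^k(B)%G).
  rewrite normal_norm ?gFnormal_trans // andbT.
  apply: (subG1_contra _ ntS); apply: subset_trans (MhoS k sC'B).
  by rewrite defS /C' /= -morphim_Mho ?morphimS.
apply/subsetP=> _ /(Mho_abelianP k pB cBB)[b Bb ->].
by rewrite (Ohm1_abelianP pB cBB) groupX //= -expgM -expnSr expB.
Qed.

Lemma irreducible_retract_eq : iota @* H = psi @* F.
Proof.
have nsWF : 'Mho^k(A) <| F by apply: gFnormal_trans.
have [i [W1 [nsW1F sW1 imW1 sepW1]]] :=
  minnormal_image_coordinate sepF minU nsWF imW.
have [sW1F nW1F] := andP nsW1F.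
have sker : W1 :&: 'ker (pi_ i) \subset W1 :&: 'ker psi.
  apply/subsetP=> w /setIP[Ww /mker w1]; rewrite inE Ww.
  by apply/kerP; rewrite ?sepW1 ?(subsetP sW1F).
have piW1 : pi_ i @* W1 \subset 'Ohm_1(C).
  apply/subsetP=> _ /morphimP[w Fw Ww ->].
  have /(Mho_abelianP k pA cAA)[a Aa def_w] := subsetP sW1 w Ww.
  have [Fa aP] := memA _ Aa.
  rewrite (Ohm1_abelianP pC cCC) def_w morphX // groupX //=.
  by rewrite -expgM -expnSr expC.
(* On [W1] the kernel of [pi_ i] is contained in that of [psi], so [U] is no larger than
   [pi_ i @* W1], a subgroup of ['Ohm_1(C)]. *)
have US : U :=: S.
  apply/eqP; rewrite eq_sym eqEcard sSU defS card_injm ?gFsub_trans //=.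
  apply: leq_trans (subset_leq_card piW1).
  rewrite -imW1 !card_morphim (setIidPr sW1F) -!(indexgI W1 ('ker _)).
  by rewrite dvdn_leq ?indexg_gt0 ?indexgS.
have CB : C' :=: B.
  apply: (eq_of_socle_sub pB cBB sC'B expB).
  have -> : 'Ohm_1(B) = S by [].
  by rewrite defS -morphim_Mho ?morphimS.
have [L] := splitsP (SchurZassenhaus_split (pHall_Hall sylB) nsBE).
case/complP=> tiBL defE.
have sLE : L \subset E by rewrite -defE mulG_subr.
have nBL := subset_trans sLE (normal_norm nsBE).
have oL : #|L| = #|E : B|.
  by rewrite -divgS ?normal_sub // -{1}defE TI_cardMg // mulKn ?cardG_gt0.
(* ['C_L(B)] is normal in [E = B * L] and meets [C'] trivially. *)
have cLB1 : 'C_L(B) = 1.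
  apply: (meetC (N := 'C_L(B)%G)).
    rewrite /normal subIset ?sLE //= -defE mul_subG //.
      by rewrite cents_norm // centsC subsetIr.
    by rewrite normsI ?normG // norms_cent.
  apply/trivgP; rewrite -tiBL setIC.
  by rewrite setISS ?subsetIl.
have cLU1 : 'C_L(U) = 1.
  apply/trivgP; rewrite -cLB1 subsetI subsetIl.
  by rewrite faithful_Ohm1_abelian // oL.
have cEU : 'C_E(U) = B.
  have sBC : B \subset 'C(U) by rewrite centsC (sub_abelian_cent2 cBB).
  by rewrite -defE -group_modl // cLU1 mulg1.
(* For [f] in [Fi] and [w] in [W1], the commutator lies in [W1] and has trivial coordinate [i], so
   [psi] kills it. Thus [Fi] maps into ['C_E(U) = B], which bounds [#|E : B|] by [#|H : C|]. *)
pose Fi := (pi_ i @*^-1 C)%G.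
have imFi : psi @* Fi \subset 'C_E(U).
  rewrite subsetI morphimS ?subsetIl //=.
  apply/centsP=> _ /morphimP[f Ff Fif ->] u Uu.
  have : u \in psi @* W1 by rewrite imW1.
  case/morphimP=> w Fw Ww ->; apply/commgP/eqP; rewrite -morphR //.
  have /morphpreP[_ Cf] := Fif.
  have Cw : pi_ i w \in C.
    by apply/(subsetP (Ohm_sub 1 C))/(subsetP piW1)/mem_morphim.
  apply: sepW1; last by rewrite morphR //; apply/eqP/commgP/(centsP cCC).
  by rewrite (subsetP _ _ (mem_commg Ff Ww)) // commg_subr.
apply/eqP; rewrite eqEcard sHE /=.
rewrite -(Lagrange (normal_sub nsBE)) -CB card_injm //.
rewrite card_injm // -(Lagrange sCH) leq_pmul2l ?cardG_gt0 //.
rewrite CB -cEU.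
apply: leq_trans (leq_indexgl C (piH i)).
rewrite -(index_morphpre C (subxx (pi_ i @* F))) morphimGK ?subsetIl //.
apply: leq_trans (dvdn_leq _ (index_morphim psi _)); rewrite ?indexg_gt0 ?subsetIl //.
by rewrite dvdn_leq ?indexg_gt0 // indexgS.
Qed.

End IrreducibleCase.

(** The retraction of [phi @* F] is given on [F]: at [h = 1] the conclusion says that [rho] kills
    the kernel of [phi], and in general that the induced map inverts [chi] on its image. *)
Lemma retraction_of_subdirect_quotient (gT fT dT : finGroupType)
    (H C : {group gT}) (F : {group fT}) (I : finType)
    (pi_ : I -> {morphism F >-> gT}) (phi : {morphism F >-> dT})
    (chi : {morphism H >-> dT}) :
    C <| H -> 'C_H(C) = C ->
    normal_indecomposable H C ->
    coprime #|C| #|H : C| ->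
    (forall i, pi_ i @* F \subset H) ->
    {in F, forall f, (forall i, pi_ i f = 1) -> f = 1} ->
    'injm chi -> chi @* H \subset phi @* F ->
  exists rho : {morphism F >-> gT},
    rho @* F \subset H /\ {in F & H, forall f h, phi f = chi h -> rho f = h}.
Proof.
move=> nsCH cHC indecC coC piH sepF inj_chi sHD; have [sCH nCH] := andP nsCH.
have cCC : abelian C by rewrite /abelian -{1}cHC subsetIr.
have [C1 | ntC] := eqVneq (C : {set gT}) 1.
  have H1 : H :=: 1 by rewrite -C1 -[RHS]cHC C1; apply/esym/setIidPl; rewrite cents1.
  exists (trivm F); rewrite morphim_trivm sub1G; split=> // f h _ Hh _.
  by apply/esym/set1gP; rewrite -H1.
have [p [k [p_pr pC expC sOM minC]]] :=
  indecomposable_irreducible_socle nsCH cCC ntC coC indecC.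
pose D := (phi @* F)%G; pose C' := (chi @* C)%G.
pose gP (R : {group dT}) := (R <| D) && (R :&: C' == 1).
have [R /maxgroupP[/andP[nsRD /eqP tiRC] maxR] _] :
    {R : {group dT} | maxgroup R gP & 1%G \subset R}.
  by apply: maxgroup_exists; rewrite /gP normal1 -subG1 subsetIl.
have [sRD nRD] := andP nsRD.
have chiD h : h \in H -> chi h \in D by move=> Hh; apply/(subsetP sHD)/mem_morphim.
have phiD f : f \in F -> phi f \in D by move=> Ff; apply: mem_morphim.
have psiM : {in F &, {morph (fun f => coset R (phi f)) : x y / x * y}}.
  by move=> x y Fx Fy /=; rewrite morphM // morphM // (subsetP nRD) ?phiD.
have iotaM : {in H &, {morph (fun h => coset R (chi h)) : x y / x * y}}.
  by move=> x y Hx Hy /=; rewrite morphM // morphM // (subsetP nRD) ?chiD.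
pose psi := Morphism psiM; pose iota := Morphism iotaM.
have im_psi : psi @* F = D / R.
  by rewrite /quotient morphimEdom (morphimEsub _ nRD) /= morphimEdom -imset_comp.
have im_iota (K : {group gT}) : K \subset H -> iota @* K = chi @* K / R.
  move=> sKH; have nRK : chi @* K \subset 'N(R).
    by rewrite (subset_trans (morphimS _ sKH)) // (subset_trans sHD).
  by rewrite /quotient (morphimEsub _ nRK) (morphimEsub chi sKH) -imset_comp -(morphimEsub iota sKH).
(* Commutators of [h] with [C] land in [R] and in [C'], hence vanish; so [h] is in ['C_H(C) = C],
   whose image avoids [R]. *)
have tiRH h : h \in H -> chi h \in R -> h = 1.
  move=> Hh Rh; suff Ch : h \in C.
    apply: (injmP inj_chi); rewrite ?morph1 //; apply/set1gP.
    by rewrite -tiRC inE Rh mem_morphim.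
  rewrite -cHC inE Hh; apply/centP=> c Cc; apply/commgP/eqP.
  have Hc := subsetP sCH c Cc.
  apply: (injmP inj_chi); rewrite ?morph1 ?groupR //; apply/set1gP.
  rewrite -tiRC inE; apply/andP; split.
    rewrite morphR // groupM ?groupV // memJ_norm ?(subsetP nRD) ?chiD //.
  apply: mem_morphim; first by rewrite groupR.
  by rewrite commgEr groupM // memJ_norm ?groupV // (subsetP nCH).
have inj_iota : 'injm iota.
  apply/subsetP=> h /morphpreP[Hh /set1P/= /coset_idr Rh].
  by apply/set1P/tiRH => //; apply: Rh; rewrite (subsetP nRD) ?chiD.
have eqHE : iota @* H = psi @* F.
  apply: (@irreducible_retract_eq _ _ _ H C F I pi_ psi iota p k) => //.
    by rewrite im_psi im_iota ?quotientS.
  (* The preimage [N1] of [N] still avoids [C'], so it is [R] by maximality. *)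
  move=> N; rewrite im_psi im_iota // => nsN tiN.
  have [N1 defN sRN1 nsN1D] := inv_quotientN nsRD nsN.
  rewrite defN (maxR N1) ?trivg_quotient // /gP nsN1D.
  apply/eqP/trivgP; rewrite -tiRC subsetI subsetIr andbT.
  apply/subsetP=> x /setIP[N1x C'x].
  have Nx : x \in 'N(R) by rewrite (subsetP nRD) // (subsetP (normal_sub nsN1D)).
  by apply: coset_idr => //; apply/set1gP; rewrite -tiN inE defN !mem_quotient.
have psiH f : f \in F -> psi f \in iota @* H.
  by move=> Ff; rewrite eqHE mem_morphim.
have rhoM : {in F &, {morph (fun f => invm inj_iota (psi f)) : x y / x * y}}.
  by move=> x y Fx Fy /=; rewrite psiM // morphM // psiH.
exists (Morphism rhoM); split=> [|f h Ff Hh /= ->]; last by rewrite (invmE inj_iota).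
apply/subsetP=> _ /morphimP[f Ff _ ->] /=.
by rewrite -(im_invm inj_iota) mem_morphim //= psiH.
Qed.

(** * Words, laws and relatively free groups *)

Lemma gmulVr (X : abs_group) (x : X) : gmul x (ginv x) = gone X.
Proof.
rewrite -[LHS]gmul1 -{1}(gmulV (ginv x)) -gmulA (gmulA (ginv x)).
by rewrite gmulV gmul1 gmulV.
Qed.

Lemma gmul1r (X : abs_group) (x : X) : gmul x (gone X) = x.
Proof. by rewrite -(gmulV x) gmulA gmulVr gmul1. Qed.

Lemma gmulI (X : abs_group) (x y z : X) : gmul x y = gmul x z -> y = z.
Proof. by move=> eq_xy; rewrite -(gmul1 y) -(gmulV x) -gmulA eq_xy gmulA gmulV gmul1. Qed.

(** Over this group [aeval] is convertible to [geval], so facts on [aeval] apply to both. *)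
Definition abs_of_fin (gT : finGroupType) : abs_group :=
  AbsGroup (@mulgA gT) (@mul1g gT) (@mulVg gT).

Lemma aevalM (X : abs_group) (A : Type) (c : A -> X) (v : nat -> X) (t1 t2 : term A) :
  aeval c v (TMul t1 t2) = gmul (aeval c v t1) (aeval c v t2).
Proof. by []. Qed.

Lemma aevalV (X : abs_group) (A : Type) (c : A -> X) (v : nat -> X) (t : term A) :
  aeval c v (TInv t) = ginv (aeval c v t).
Proof. by []. Qed.

(** The predicate [P] admits maps that are multiplicative only on a subgroup, such as morphisms with
    a restricted domain. *)
Lemma aeval_morph (X Y : abs_group) (P : X -> Prop) (f : X -> Y) (A : Type)
    (c : A -> X) (v : nat -> X) (t : term A) :
    P (gone X) -> (forall x y, P x -> P y -> P (gmul x y)) ->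
    (forall x, P x -> P (ginv x)) ->
    (forall x y, P x -> P y -> f (gmul x y) = gmul (f x) (f y)) ->
    (forall a, P (c a)) -> (forall i, P (v i)) ->
  P (aeval c v t) /\
  f (aeval c v t) = aeval (fun a => f (c a)) (fun i => f (v i)) t.
Proof.
move=> P1 PM PV fM Pc Pv.
have f1 : f (gone X) = gone Y.
  by apply: (@gmulI _ (f (gone X))); rewrite -fM // gmul1 gmul1r.
have fV x : P x -> f (ginv x) = ginv (f x).
  move=> Px; apply: (@gmulI _ (f x)).
  by rewrite -fM ?gmulVr //; apply: PV.
elim: t => [i | a | t1 [P1' IH1] t2 [P2' IH2] | t1 [P1' IH1] |].
- by split; first exact: Pv.
- by split; first exact: Pc.
- by rewrite !aevalM fM // IH1 IH2; split=> //; apply: PM.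
- by rewrite !aevalV fV // IH1; split=> //; apply: PV.
- by split; first exact: P1.
Qed.

Fixpoint tbind (A B : Type) (s : nat -> term B) (k : A -> term B) (t : term A) : term B :=
  match t with
  | TVar i => s i
  | TCst a => k a
  | TMul t1 t2 => TMul (tbind s k t1) (tbind s k t2)
  | TInv t1 => TInv (tbind s k t1)
  | TOne => TOne
  end.

Lemma aeval_bind (X : abs_group) (A B : Type) (c : B -> X) (v : nat -> X)
    (s : nat -> term B) (k : A -> term B) (t : term A) :
  aeval c v (tbind s k t) = aeval (fun a => aeval c v (k a)) (fun i => aeval c v (s i)) t.
Proof.
elim: t => // [t1 IH1 t2 IH2 | t1 IH1]; rewrite [tbind _ _ _]/=.
- by rewrite !aevalM IH1 IH2.
- by rewrite !aevalV IH1.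
Qed.

Fixpoint tvars (A : Type) (t : term A) : seq nat :=
  match t with
  | TVar i => [:: i]
  | TMul t1 t2 => tvars t1 ++ tvars t2
  | TInv t1 => tvars t1
  | _ => [::]
  end.

Lemma aeval_eq_in (X : abs_group) (A : eqType) (c c' : A -> X) (v v' : nat -> X)
    (t : term A) :
  {in tconsts t, c =1 c'} -> {in tvars t, v =1 v'} -> aeval c v t = aeval c' v' t.
Proof.
elim: t => [i | a | t1 IH1 t2 IH2 | t1 IH1 |] // eq_c eq_v.
- by apply: eq_v; rewrite mem_seq1.
- by apply: eq_c; rewrite mem_seq1.
- rewrite !aevalM IH1 ?IH2 // => x tx;
    by (apply: eq_c || apply: eq_v); rewrite /= mem_cat tx ?orbT.
- by rewrite !aevalV IH1.
Qed.

Definition aevalw (X : abs_group) (v : nat -> X) (w : word) : X :=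
  aeval (of_void X) v w.

Lemma aevalw_eq (X : abs_group) (v v' : nat -> X) (w : word) :
  v =1 v' -> aevalw v w = aevalw v' w.
Proof. by move=> eq_v; apply: aeval_eq_in => [[] | i _]. Qed.

Lemma aevalw_morph (X Y : abs_group) (P : X -> Prop) (f : X -> Y)
    (v : nat -> X) (w : word) :
    P (gone X) -> (forall x y, P x -> P y -> P (gmul x y)) ->
    (forall x, P x -> P (ginv x)) ->
    (forall x y, P x -> P y -> f (gmul x y) = gmul (f x) (f y)) ->
    (forall i, P (v i)) ->
  f (aevalw v w) = aevalw (fun i => f (v i)) w.
Proof.
move=> P1 PM PV fM Pv.
have [|_ ->] := @aeval_morph X Y P f void (of_void X) v w P1 PM PV fM _ Pv; first by case.
by apply: aeval_eq_in => [[]|].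
Qed.

Definition is_law (gT : finGroupType) (H : {set gT}) (w : word) : Prop :=
  forall v : nat -> gT, (forall i, v i \in H) -> geval (of_void gT) v w = 1.

(** Membership in the verbal subgroup. Single values suffice without generation, since the product
    of two laws in disjoint variables is again a law. *)
Definition verbal_value (gT : finGroupType) (H : {set gT}) (X : abs_group) (x : X) : Prop :=
  exists w v, is_law H w /\ aevalw v w = x.

Section VerbalValue.

Variables (gT : finGroupType) (H : {group gT}) (X : abs_group).

Lemma verbal_value1 : verbal_value H (gone X).
Proof. by exists TOne, (fun _ => gone X). Qed.

Lemma verbal_valueM (x y : X) :
  verbal_value H x -> verbal_value H y -> verbal_value H (gmul x y).
Proof.
move=> [w1 [v1 [law1 <-]]] [w2 [v2 [law2 <-]]].
(* Even variables for [w1], odd ones for [w2]. *)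
pose w (b : bool) : word -> word := tbind (fun i => TVar _ (b + i.*2)%N) (@of_void _).
have evw (Y : abs_group) b (v : nat -> Y) u :
    aevalw v (w b u) = aevalw (fun i => v (b + i.*2)%N) u.
  by rewrite /aevalw aeval_bind; apply: aeval_eq_in => [[] |].
exists (TMul (w false w1) (w true w2)).
exists (fun i => if odd i then v2 i./2 else v1 i./2); split=> [v Hv|].
  have -> : geval (of_void gT) v (TMul (w false w1) (w true w2)) =
    aevalw (X := abs_of_fin gT) v (w false w1) *
    aevalw (X := abs_of_fin gT) v (w true w2) by [].
  by rewrite !evw [X in X * _]law1 // [X in _ * X]law2 // mulg1.
rewrite -[LHS]/(gmul (aevalw _ (w false w1)) (aevalw _ (w true w2))) !evw.
congr gmul; apply: aevalw_eq => i /=; rewrite ?add0n ?add1n ?oddS odd_double //=.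
  by rewrite doubleK.
by rewrite uphalf_double.
Qed.

Lemma verbal_valueV (x : X) : verbal_value H x -> verbal_value H (ginv x).
Proof.
move=> [w [v [laww <-]]]; exists (TInv w), v; split=> // v' Hv'.
by rewrite -[LHS]/((geval _ _ w)^-1) laww // invg1.
Qed.

Lemma verbal_valueJ (x y : X) :
  verbal_value H x -> verbal_value H (gmul (gmul y x) (ginv y)).
Proof.
move=> [w [v [laww <-]]].
exists w, (fun i => gmul (gmul y (v i)) (ginv y)); split=> //; apply/esym.
apply: (@aevalw_morph X X (fun=> True) (fun z => gmul (gmul y z) (ginv y))) => // a b _ _.
by rewrite !gmulA -(gmulA _ _ y) gmulV gmul1r.
Qed.

End VerbalValue.

(** * Relatively free groups of finite rank inside finite powers *)

Section RelativelyFree.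

Variables (gT : finGroupType) (H : {group gT}) (M : nat).
Variables (X : abs_group) (v : nat -> X).
Hypothesis v_out : forall i, M <= i -> v i = gone X.

Let J := {ffun 'I_M -> gT}.
Let fT : finGroupType := {dffun forall _ : J, gT}.

(* Coordinates range over assignments in all of [gT]; values outside [H], and
   variables beyond [M], are read as [1]. *)
Definition free_gen (i : nat) : fT :=
  @finfun J (fun=> gT : Type)
    (fun j => if insub i is Some i' then if j i' \in H then j i' else 1 else 1).

Definition free_eval (w : word) : fT := aevalw (X := abs_of_fin fT) free_gen w.

Lemma free_evalE (w : word) (j : J) :
  free_eval w j = geval (of_void gT) (fun i => free_gen i j) w.
Proof.
apply: (@aevalw_morph (abs_of_fin fT) (abs_of_fin gT) (fun=> True) (fun f : fT => f j)).
all: by move=> // x y _ _; rewrite [LHS]ffunE.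
Qed.

Lemma free_gen_mem (i : nat) (j : J) : free_gen i j \in H.
Proof. by rewrite ffunE; case: insubP => [i' _ _|]; [case: ifP|]. Qed.

Lemma free_eval_mem (w : word) (j : J) : free_eval w j \in H.
Proof.
rewrite free_evalE; elim: w => [i | [] | w1 IH1 w2 IH2 | w1 IH1 |].
- exact: free_gen_mem.
- exact: groupM.
- exact: groupVr.
- exact: group1.
Qed.

(** Reading the variables from [M] on as [1] turns [w] into a law, as its value at any assignment in
    [H] is a coordinate of [free_eval w]. The value at [v] is unchanged because [v] is trivial
    there. *)
Lemma free_eval_verbal (w : word) :
  free_eval w = 1 -> verbal_value H (aevalw v w).
Proof.
move=> w1; pose s i : word := if i < M then TVar _ i else TOne.
exists (tbind s (@of_void _) w), v; split=> [v0 Hv0|]; last first.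
  rewrite /aevalw aeval_bind; apply: aeval_eq_in => [[] // | i _].
  by rewrite /s; case: ltnP => // /v_out->.
pose j : J := [ffun i : 'I_M => v0 i].
have := free_evalE w j; rewrite w1 oneg_ffun => ->.
rewrite -[LHS]/(aeval (X := abs_of_fin gT) _ _ _) aeval_bind.
apply: (@aeval_eq_in (abs_of_fin gT)) => [[] // | i _].
rewrite ffunE /s; case: insubP => [i' ltiM def_i|].
  by rewrite ltiM ffunE Hv0 def_i.
by move/negbTE->.
Qed.

Definition free_set := [set f : fT | `[< exists w, free_eval w = f >]].

Lemma free_setP f : reflect (exists w, free_eval w = f) (f \in free_set).
Proof. by rewrite inE; apply: asboolP. Qed.

Lemma free_group_set : group_set free_set.
Proof.
apply/group_setP; split=> [|f g]; first by apply/free_setP; exists TOne.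
move=> /free_setP[w1 <-] /free_setP[w2 <-].
by apply/free_setP; exists (TMul w1 w2).
Qed.
Definition free_group := Group free_group_set.

(** [X] may violate the laws of [H], so [v] induces a map on the relatively free group only modulo
    verbal values; this is the kernel of that map. *)
Definition verbal_kernel_set :=
  [set f : fT | `[< exists w, free_eval w = f /\ verbal_value H (aevalw v w) >]].

Lemma verbal_kernelP f :
  reflect (exists w, free_eval w = f /\ verbal_value H (aevalw v w))
          (f \in verbal_kernel_set).
Proof. by rewrite inE; apply: asboolP. Qed.

Lemma verbal_kernel_group_set : group_set verbal_kernel_set.
Proof.
apply/group_setP; split=> [|f g].
  by apply/verbal_kernelP; exists TOne; split=> //; apply: verbal_value1.
move=> /verbal_kernelP[w1 [<- V1]] /verbal_kernelP[w2 [<- V2]].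
apply/verbal_kernelP; exists (TMul w1 w2); split=> //.
exact: verbal_valueM.
Qed.
Definition verbal_kernel := Group verbal_kernel_group_set.

Lemma verbal_kernel_norm : free_group \subset 'N(verbal_kernel).
Proof.
apply/subsetP=> f /free_setP[u <-]; rewrite inE.
apply/subsetP=> _ /imsetP[_ /verbal_kernelP[w [<- Vw]] ->].
apply/verbal_kernelP; exists (TMul (TMul (TInv u) w) (TInv (TInv u))); split.
  by rewrite -[LHS]/((_^-1 * _) * _^-1^-1) invgK conjgE mulgA.
exact: (@verbal_valueJ _ _ _ _ (ginv (aevalw v u))).
Qed.

(** Membership does not depend on the representing word: two words with the same [free_eval] differ
    by one that evaluates to [1], and its value at [v] is verbal. *)
Lemma mem_verbal_kernel (w : word) :
  (free_eval w \in verbal_kernel) <-> verbal_value H (aevalw v w).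
Proof.
split=> [/verbal_kernelP[w' [eq_w Vw']] | Vw]; last by apply/verbal_kernelP; exists w.
have /free_eval_verbal : free_eval (TMul (TInv w') w) = 1.
  by rewrite -[LHS]/((free_eval w')^-1 * free_eval w) eq_w mulVg.
rewrite /aevalw aevalM aevalV => /(verbal_valueM Vw').
by rewrite /aevalw gmulA gmulVr gmul1.
Qed.

End RelativelyFree.

(** The variables selected by [idx] form a copy of [H] modulo the verbal kernel; the solution [u] is
    the image of the free generators under the retraction onto that copy. *)
Lemma word_solution (gT : finGroupType) (H C : {group gT}) (X : abs_group)
    (M : nat) (v : nat -> X) (idx : gT -> nat) :
    C <| H -> 'C_H(C) = C ->
    normal_indecomposable H C ->
    coprime #|C| #|H : C| ->
    (forall i, M <= i -> v i = gone X) ->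
    {in H &, forall x y, v (idx (x * y)) = gmul (v (idx x)) (v (idx y))} ->
    {in H, forall h, verbal_value H (v (idx h)) -> h = 1} ->
  exists u : nat -> gT,
    [/\ forall i, u i \in H, {in H, forall h, u (idx h) = h}
      & forall w, aevalw v w = gone X -> geval (of_void gT) u w = 1].
Proof.
move=> nsCH cHC indecC coC v_out vM v_inj.
pose F := free_group H M; pose N := verbal_kernel H M v.
pose x := @free_gen gT H M; have Fx i : x i \in F by apply/free_setP; exists (TVar _ i).
have nNF : F \subset 'N(N) := verbal_kernel_norm H M v.
have memN := mem_verbal_kernel H v_out.
pose pi_ j := restrm (subsetT F) (@dffun_morphism {ffun 'I_M -> gT} (fun=> gT) j).
pose phi := restrm nNF (coset N).
have Nx i : x i \in 'N(N) by rewrite (subsetP nNF).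
have chiM : {in H &, {morph (fun h => coset N (x (idx h))) : a b / a * b}}.
  move=> a b Ha Hb /=; rewrite -morphM //.
  apply/(rcoset_kercosetP (Nx _) (groupM (Nx _) (Nx _))); rewrite mem_rcoset.
  apply/(memN (TMul (TVar _ (idx (a * b)))
                    (TInv (TMul (TVar _ (idx a)) (TVar _ (idx b)))))).
  rewrite /aevalw !aevalM aevalV aevalM -[aeval _ _ _]/(v (idx (a * b))).
  by rewrite vM // gmulVr; apply: verbal_value1.
pose chi := Morphism chiM.
have inj_chi : 'injm chi.
  apply/subsetP=> h /morphpreP[Hh /set1P/= /(coset_idr (Nx _)) Nh].
  by apply/set1P/v_inj => //; apply/(memN (TVar _ (idx h))).
have [|||rho [rhoH rhoE]] := @retraction_of_subdirect_quotient
    gT _ _ H C F _ pi_ phi chi nsCH cHC indecC coC _ _ inj_chi.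
- move=> j; apply/subsetP=> _ /morphimP[f _ /free_setP[w <-] ->].
  exact: free_eval_mem.
- by move=> f _ f1; apply/ffunP=> j; rewrite oneg_ffun; apply: f1.
- by apply/subsetP=> _ /morphimP[h _ Hh ->]; apply: mem_morphim (Fx (idx h)) (Fx _).
exists (fun i => rho (x i)); split=> [i|h Hh|w vw1].
- by apply/(subsetP rhoH)/mem_morphim.
- exact: rhoE.
(* A relation satisfied by [v] lies in the verbal kernel, so [rho] kills it, by the retraction
   property at [h = 1]. *)
have Nw : free_eval H M w \in N by apply/memN; rewrite vw1; apply: verbal_value1.
have Fw : free_eval H M w \in F by apply/free_setP; exists w.
have <- : rho (free_eval H M w) = 1.
  by apply: rhoE => //; rewrite morph1; apply: coset_id.
apply/esym.
apply: (@aevalw_morph (abs_of_fin _) (abs_of_fin gT) (fun f => f \in F) rho) => //.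
- exact: (group1 F).
- by move=> a b Fa Fb; apply: (@groupM _ F a b).
- by move=> a Fa; apply: (@groupVr _ F a).
- by move=> a b Fa Fb; apply: (morphM rho).
Qed.

Lemma equation_solution (gT : finGroupType) (H C : {group gT}) (X : abs_group)
    (e : gT -> X) (v : nat -> X) (n : nat) :
    C <| H -> 'C_H(C) = C ->
    normal_indecomposable H C ->
    coprime #|C| #|H : C| ->
    {in H &, forall x y, e (x * y) = gmul (e x) (e y)} ->
    {in H, forall h, verbal_value H (e h) -> h = 1} ->
  exists2 u : nat -> gT, forall i, u i \in H &
    forall t : term gT, all (fun a => a \in H) (tconsts t) ->
      all (fun i => i < n) (tvars t) ->
      aeval e v t = gone X -> geval id u t = 1.
Proof.
move=> nsCH cHC indecC coC eM e_inj.
(* Constants become variables: slots from [n] on hold the images of the elements of [gT], and all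
   later slots are trivial, so that finite rank suffices. *)
pose v' i := if i < n then v i
  else if i < n + #|gT| then e (nth 1 (enum gT) (i - n)) else gone X.
pose idx (a : gT) := n + index a (enum gT).
have v'_idx a : v' (idx a) = e a.
  rewrite /v' /idx ltnNge leq_addr /= ltn_add2l cardE index_mem mem_enum inE.
  by rewrite addKn nth_index // mem_enum.
have [|||u [Hu uH uw]] := @word_solution gT H C X (n + #|gT|) v' idx nsCH cHC indecC coC.
- move=> i le_i; rewrite /v' ltnNge (leq_trans (leq_addr _ _) le_i) /=.
  by rewrite ltnNge le_i.
- by move=> a b Ha Hb; rewrite !v'_idx eM.
- by move=> h Hh; rewrite v'_idx; apply: e_inj.
exists u => // t /allP constH /allP varn t1.
pose wt : word := tbind (fun i => TVar _ i) (fun a => TVar _ (idx a)) t.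
have <- : geval (of_void gT) u wt = 1.
  apply: uw; rewrite -t1 /aevalw aeval_bind; apply: aeval_eq_in => [a _ | i /varn lt_in].
    exact: v'_idx.
  by rewrite -[LHS]/(v' i) /v' lt_in.
apply/esym; rewrite -[LHS]/(aeval (X := abs_of_fin gT) _ _ _) aeval_bind.
by apply: (@aeval_eq_in (abs_of_fin gT)) => [a /constH /uH | ].
Qed.

Lemma tvars_bounded (A : Type) (S : seq (term A)) :
  exists n, forall t, List.In t S -> all (fun i => i < n) (tvars t).
Proof.
elim: S => [|t S [n IHn]]; first by exists 0.
exists (maxn (\max_(i <- tvars t) i).+1 n) => t1 [<- | /IHn/allP St1]; apply/allP=> i ti.
  by rewrite leq_max ltnS leq_bigmax_seq.
by rewrite leq_max St1 // orbT.
Qed.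

Theorem theorem2 (gT : finGroupType) (H C : {group gT}) :
  (C <| H)%g ->
  'C_H(C)%g = C ->
  ~ (exists A B : {group gT},
       [/\ (A <| H)%g, (B <| H)%g, A :!=: 1%g, B :!=: 1%g & (A \x B)%g = C]) ->
  coprime #|C| #|(H / C)%g| ->
  (forall G : {group gT}, H \subset G -> satisfies_identities_of G H ->
     retract_of H G)
  /\ strongly_verbally_closed H.
Proof.
move=> nsCH cHC indecC; rewrite card_quotient ?normal_norm // => coC.
split=> [G sHG idG | X e [eM e_inj] vcH S constS [v vS]].
  (* The system is the multiplication table of [G], one variable per element, together with
     equations setting the variable of each [h] in [H] to [h]. It holds tautologically in [G], and a
     solution in [H] is a retraction. *)
  pose X := abs_of_fin (subg_of G); pose e : gT -> X := subg G.
  pose s := enum (subg_of G); pose v i : X := nth 1 s i.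
  pose r (g : gT) := index (subg G g) s.
  have vr g : v (r g) = subg G g by rewrite /v nth_index // mem_enum.
  have lt_r g : r g < #|{: subg_of G}| by rewrite cardE index_mem mem_enum.
  have [||u Hu uP] := @equation_solution gT H C X e v #|{: subg_of G}| nsCH cHC indecC coC.
  - by move=> x y Hx Hy; rewrite /e morphM ?(subsetP sHG).
  - move=> h Hh [w [v0 [laww w_h]]].
    have <- : sgval (subg G h) = h by rewrite subgK ?(subsetP sHG).
    rewrite -[subg G h]w_h.
    rewrite (@aevalw_morph X (abs_of_fin gT) (fun=> True) (@sgval _ G)) //.
    by apply: idG => // i; apply: subgP.
  have rhoM : {in G &, {morph (fun g => u (r g)) : a b / a * b}}.
    move=> a b Ga Gb /=; apply/eqP; rewrite eq_mulgV1; apply/eqP.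
    apply: (uP (TMul (TVar _ (r (a * b))) (TInv (TMul (TVar _ (r a)) (TVar _ (r b))))))
      => //=; rewrite ?lt_r //.
    rewrite aevalM aevalV aevalM -[LHS]/(v _ * (v _ * v _)^-1) !vr morphM //.
    exact: mulgV.
  have rhoH h : h \in H -> u (r h) = h.
    move=> Hh; apply/eqP; rewrite eq_mulgV1; apply/eqP.
    apply: (uP (TMul (TVar _ (r h)) (TInv (TCst h)))); rewrite /= ?Hh ?lt_r //.
    by rewrite aevalM aevalV -[LHS]/(v _ * (e h)^-1) vr mulgV.
  exists (Morphism rhoM); split=> [|x Gx]; last by rewrite /= rhoH.
  apply/eqP; rewrite eqEsubset; apply/andP; split; apply/subsetP=> h.
    by case/morphimP=> g _ _ -> /=; apply: Hu.
  move=> Hh; have Gh := subsetP sHG h Hh.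
  by rewrite -{1}(rhoH h Hh); apply: (mem_morphim (Morphism rhoM)).
have [n varn] := tvars_bounded S.
have [|u Hu uP] := @equation_solution gT H C X e v n nsCH cHC indecC coC eM.
  (* Verbal closedness: if a law [w] takes the value [e h] in [X], then [w = h] is solvable in [H],
     where [w] vanishes. *)
  move=> h Hh [w [v0 [laww w_h]]].
  by have [|v1 [Hv1 <-]] := vcH w h Hh; [exists v0 | apply: laww].
by exists u; split=> // t St; apply: uP; rewrite ?vS ?constS ?varn.
Qed.
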